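(* Let $\eta=(\eta_1,\dots,\eta_t)$ be a sequence of positive integers with sum $n$, let $R=(R_1,\dots,R_t)$ with $R_i=(\mu_i^{\eta_i})$ the rectangle with $\eta_i$ rows and $\mu_i$ columns, and let $S$ be a column strict tableau of partition shape $\lambda$ with entries in $[n]=\{1,\dots,n\}$. Let $k$ be a positive integer with $k\ge\lambda_1$ and $k\ge\mu_i$ for all $i$, let $\widetilde R=(\widetilde R_1,\dots,\widetilde R_t)$ with $\widetilde R_i=((k-\mu_i)^{\eta_i})$, and let $\widetilde S$ be the dual tableau of $S$ with respect to the $n\times k$ rectangle. Then $S$ is $R$-column catabolizable if and only if $\widetilde S$ is $\widetilde R$-column catabolizable.
   Context: Tableaux are in English notation; column strict means weakly increasing along rows and strictly increasing down columns. $S|_A$ is the subtableau of entries in $A$. The row-reading word of a (skew) tableau reads rows from bottom to top, each row left to right; $P(w)$ is the Schensted insertion tableau of the word $w$, and for skew tableaux $X,Y$, $P(XY)$ is $P$ of the concatenation of the row-reading word of $X$ followed by that of $Y$. Dual tableau: $\widetilde S$ is the column strict tableau of shape $(k-\lambda_n,\dots,k-\lambda_1)$ whose $j$-th column is the set complement in $[n]$ of the $(k+1-j)$-th column of $S$, $1\le j\le k$ (missing columns are regarded as empty). Alphabets: $A_1,\dots,A_t$ are the successive subintervals of $[n]$ of sizes $\eta_1,\dots,\eta_t$. $K_i$ is the rectangular tableau of shape $R_i$ whose $j$-th row consists of $\mu_i$ copies of the $j$-th smallest letter of $A_i$, $1\le j\le\eta_i$. (For $\widetilde R$ the alphabets are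 the same and $\mu_i$ is replaced by $k-\mu_i$; rectangles with zero columns are allowed and then $K_i$ is empty.) Column catabolizability: let $S$ be a column strict tableau of partition shape with $S|_{A_1}=K_1$. Let $S_l$ and $S_r$ be the left and right subtableaux obtained by slicing the skew tableau $S-K_1$ vertically just after the $\mu_1$-th column. The $R_1$-column catabolism of $S$ is the tableau $\mathrm{CCat}_{R_1}(S)=P(S_rS_l)$. A column strict tableau $S$ of partition shape is $R$-column catabolizable if $S|_{A_1}=K_1$ and $\mathrm{CCat}_{R_1}(S)$ is $\widehat R$-column catabolizable in the alphabet $[n]-A_1=\{\eta_1+1,\dots,n\}$, where $\widehat R=(R_2,R_3,\dots,R_t)$. The empty tableau is considered to be the unique catabolizable tableau for the empty sequence of rectangles. *)

(* Defs.v *)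
(* Mathematical Components; English notation, rows and columns indexed from 0,
   letters are the natural numbers 1, ..., n. *)
From mathcomp Require Import all_boot.

Set Implicit Arguments.
Unset Strict Implicit.
Unset Printing Implicit Defensive.

(* A tableau of partition shape is the list of its rows, top to bottom, none of
   them empty (see [cstab]); this makes the representation unique. *)
Definition tableau := seq (seq nat).

(* A skew tableau is given cell by cell: row -> column -> entry, with [None]
   outside the shape, so that equality [=2] compares shapes in position too. *)
Definition filling := nat -> nat -> option nat.

Definition entry (S : tableau) : filling := fun i j => onth (nth [::] S i) j.

Definition column (S : tableau) (j : nat) : seq nat :=
  pmap (fun r => onth r j) S.

Definition cstab (n : nat) (S : tableau) : bool :=
  [&& all (fun r => r != [::]) S,
      sorted geq (shape S),
      all (fun r => all (fun x => 1 <= x <= n) r) S,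
      all (sorted leq) S &
      all (fun j => sorted ltn (column S j)) (iota 0 (head 0 (shape S)))].

(* Schensted row insertion: [x] replaces the leftmost entry of the row that is
   strictly larger, which is then inserted in the next row; if there is none,
   [find] returns the length of the row and [x] is appended. *)
Fixpoint insert (S : tableau) (x : nat) : tableau :=
  if S is r :: S' then
    let p := find (ltn x) r in
    if onth r p is Some y then set_nth 0 r p x :: insert S' y
    else rcons r x :: S'
  else [:: [:: x]].

Definition Schensted (w : seq nat) : tableau := foldl insert [::] w.

(* [F] is supported in the first [h] rows and the first [w] columns. *)
Definition row_reading (h w : nat) (F : filling) : seq nat :=
  flatten [seq pmap (F i) (iota 0 w) | i <- rev (iota 0 h)].

Definition restrict (A : pred nat) (F : filling) : filling :=
  fun i j => obind (fun x => if A x then Some x else None) (F i j).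

Definition remove (F K : filling) : filling :=
  fun i j => if K i j is Some _ then None else F i j.

Definition left_slice (c : nat) (F : filling) : filling :=
  fun i j => if j < c then F i j else None.

Definition right_slice (c : nat) (F : filling) : filling :=
  fun i j => if c <= j then F i j else None.

(* A rectangle is a pair (eta, mu): eta rows and mu columns.  [a] is the first
   letter of its alphabet {a, ..., a + eta - 1}. *)
Definition alphabet (a : nat) (R : nat * nat) : pred nat :=
  fun x => a <= x < a + R.1.

Definition rect_tab (a : nat) (R : nat * nat) : filling :=
  fun i j => if (i < R.1) && (j < R.2) then Some (a + i) else None.

Definition CCat (a : nat) (R : nat * nat) (S : tableau) : tableau :=
  let word := row_reading (size S) (head 0 (shape S)) in
  let F := remove (entry S) (rect_tab a R) in
  Schensted (word (right_slice R.2 F) ++ word (left_slice R.2 F)).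

(* [a] is the smallest letter of the current alphabet. *)
Fixpoint col_catabolizable_from
    (a : nat) (Rs : seq (nat * nat)) (S : tableau) : Prop :=
  if Rs is R :: Rs' then
    restrict (alphabet a R) (entry S) =2 rect_tab a R /\
    col_catabolizable_from (a + R.1) Rs' (CCat a R S)
  else S = [::].

Definition col_catabolizable := col_catabolizable_from 1.

Definition dual_column (n k : nat) (S : tableau) (j : nat) : seq nat :=
  [seq x <- iota 1 n | x \notin column S (k.-1 - j)].

(* The dual in the n x k rectangle, transcribed from columns to rows; rows of
   length 0 (where lambda_i = k) are dropped. *)
Definition dual_tab (n k : nat) (S : tableau) : tableau :=
  [seq r <- [seq pmap (fun j => onth (dual_column n k S j) i) (iota 0 k)
            | i <- iota 0 n]
  | r != [::]].

(* Main.v *)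
Require Import Defs.
From Stdlib Require Import Setoid Morphisms.
From mathcomp Require Import all_boot.
From mathcomp Require Import zify.

Set Implicit Arguments.
Unset Strict Implicit.
Unset Printing Implicit Defensive.

(* Read a tableau in the n x k rectangle as a sequence of k subsets of [n], its
   columns; dualizing complements the subsets and reverses the sequence.  If two
   adjacent columns C, D do not form a tableau, the crystal operator of gl_2
   moves one letter from D to C without changing the plactic class of the word
   of the columns.  The moved letter depends only on the differences
   #(D & [1, y]) - #(C & [1, y]), which are unchanged when (C, D) is replaced by
   the complements of (D, C), so the same move happens in the dual sequence.
   Iterating, a sequence of columns and its dual are straightened to dual
   tableaux.  Slicing S - K_1 and exchanging the two parts commutes with
   dualizing, hence so does CCat, and one concludes by induction on the number
   of rectangles. *)

(** * Row insertion and the Knuth relations *)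

Definition row_sorted (T : tableau) : bool := all (sorted leq) T.

Lemma sorted_split (r : seq nat) (x : nat) :
  sorted leq r -> exists lo hi,
    [/\ r = lo ++ hi, all (geq x) lo & all (ltn x) hi].
Proof.
elim: r => [|y r IHr] /= => [_|yr]; first by exists [::], [::].
have [ley | ltx] := leqP y x.
  have [lo [hi [-> lo_x hi_x]]] := IHr (path_sorted yr).
  by exists (y :: lo), hi; rewrite /= ley.
exists [::], (y :: r); split=> //=; rewrite ltx.
apply/allP=> z /(allP (order_path_min leq_trans yr)); exact: leq_trans.
Qed.

Lemma all_geqW (x y : nat) (s : seq nat) :
  x <= y -> all (geq x) s -> all (geq y) s.
Proof. by move=> xy; apply: sub_all => z zx; exact: leq_trans xy. Qed.

Lemma all_ltnW (x y : nat) (s : seq nat) :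
  x <= y -> all (ltn y) s -> all (ltn x) s.
Proof. by move=> xy; apply: sub_all => z; exact: leq_ltn_trans. Qed.

Lemma all_take1 (p : pred nat) (s : seq nat) : all p s -> all p (take 1 s).
Proof. by case: s => //= x s /andP[-> _]; rewrite take0. Qed.

(** The term [behead hi] treats bumping and appending at once: when [hi] is empty, [x] is appended.
    Only the first letter of [hi] has to exceed [x], since [find] stops there. *)
Lemma insert_split (r lo hi : seq nat) (S : tableau) (x : nat) :
    r = lo ++ hi -> all (geq x) lo -> all (ltn x) (take 1 hi) ->
  insert (r :: S) x =
    (lo ++ x :: behead hi) :: (if hi is y :: _ then insert S y else S).
Proof.
move=> -> lo_x hi_x.
have findE : find (ltn x) (lo ++ hi) = size lo.
  rewrite find_cat; have -> /= : has (ltn x) lo = false.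
    by apply/negbTE; rewrite -all_predC; apply: sub_all lo_x => y /=; lia.
  case: hi hi_x => [_|h hi] /=; first by rewrite addn0.
  by case/andP=> -> _; rewrite addn0.
rewrite /= findE; case: hi {findE} hi_x => [|h hi] _ /=.
  by rewrite cats0 onth_default // cats1.
rewrite onth_cat ltnn subnn /=.
congr cons.
by elim: lo {lo_x} => [|l lo IHlo] //=; congr cons.
Qed.

Lemma insert_sorted (S : tableau) (x : nat) :
  row_sorted S -> row_sorted (insert S x).
Proof.
elim: S x => [//|r S IHS] x /andP[r_s S_s].
have [lo [hi [rE lo_x hi_x]]] := sorted_split x r_s.
rewrite (insert_split _ rE lo_x); last exact: all_take1.
rewrite /row_sorted /=; apply/andP; split; last first.
  by case: (hi) => [//|y hi']; exact: IHS.
move: r_s; rewrite rE !sorted_pairwise; try exact: leq_trans.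
rewrite !pairwise_cat /= => /and3P[lohi -> hi_s] /=.
apply/and3P; split.
- apply/allrelP=> u v ulo; rewrite inE => /orP[/eqP-> | vhi].
    exact: (allP lo_x).
  by apply: (allrelP lohi) => //; apply: mem_behead.
- by apply/allP=> v /mem_behead /(allP hi_x) /ltnW.
- by case: (hi) hi_s => //= y hi' /andP[].
Qed.

Lemma foldl_insert_sorted (w : seq nat) (S : tableau) :
  row_sorted S -> row_sorted (foldl insert S w).
Proof. by elim: w S => //= x w IHw S /insert_sorted/IHw. Qed.

(** Both relations are proved together by following the letters bumped into the next row. For the
    first relation they again satisfy the first one; for the second relation they satisfy the second
    one, or the first one when no letter of the row lies in (x, z]. When a letter is appended
    instead of bumping, the letters passed down are the same on both sides. *)
Lemma knuth_yzx_xzy (S : tableau) : row_sorted S ->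
  (forall x y z, x < y <= z ->
     insert (insert (insert S y) z) x = insert (insert (insert S y) x) z) /\
  (forall x y z, x <= y < z ->
     insert (insert (insert S x) z) y = insert (insert (insert S z) x) y).
Proof.
elim: S => [_|r S IHS /andP[r_s S_s]].
  split=> x y z /andP[xy yz] /=.
    have xz := leq_trans xy yz.
    by rewrite xy [z < y]ltnNge yz /= xy /= [z < x]ltnNge (ltnW xz).
  have xz := leq_ltn_trans xy yz.
  by rewrite xz [z < x]ltnNge (ltnW xz) /= ![y < x]ltnNge xy yz.
have [IH1 IH2] := IHS S_s.
split=> x y z /andP[xy yz].
- have [AB [E [rE AB_y E_y]]] := sorted_split y r_s.
  have AB_s : sorted leq AB by move: r_s; rewrite rE => /cat_sorted2[].
  have E_s : sorted leq E by move: r_s; rewrite rE => /cat_sorted2[].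
  have [A [B [ABE A_x B_x]]] := sorted_split x AB_s.
  have E's : sorted leq (behead E) by case: (E) E_s => //= ? ? /path_sorted.
  have [C [D [CDE C_z D_z]]] := sorted_split z E's.
  (* [b] is the letter that [x] bumps once [y] is in the row: the first letter of [B], or [y]
     itself. *)
  have [b [B' [bE xb b_y B'_y]]] : exists b B', [/\ rcons B y = b :: B', x < b,
      b <= y & all (geq y) B'].
    move: B_x AB_y; rewrite ABE all_cat => + /andP[_].
    case: (B) => [|b B'] /=; first by exists y, [::]; split.
    move=> /andP[xb _] /andP[b_y B'_y].
    by exists b, (rcons B' y); split=> //; rewrite all_rcons /= leqnn.
  rewrite (insert_split S rE AB_y (all_take1 E_y)).
  set S1 := (if E is _ :: _ then _ else _).
  have rowy : AB ++ y :: behead E = A ++ (b :: B') ++ C ++ D.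
    by rewrite -bE -cats1 CDE ABE -!catA.
  have rowz u v : (AB ++ y :: C) ++ u :: v = A ++ (b :: B') ++ C ++ u :: v.
    by rewrite -bE -cats1 ABE -!catA.
  rewrite (@insert_split _ (AB ++ y :: C) D); first last.
  - exact: all_take1.
  - by rewrite all_cat /= yz C_z (all_geqW yz).
  - by rewrite CDE -catA.
  set S2 := (if D is _ :: _ then _ else _).
  rewrite rowy.
  rewrite (@insert_split (A ++ (b :: B') ++ C ++ D) A ((b :: B') ++ C ++ D)) //;
    last by rewrite /= take0 xb.
  rewrite rowz (@insert_split _ A ((b :: B') ++ C ++ z :: behead D)) //;
    last by rewrite /= take0 xb.
  rewrite (@insert_split _ (A ++ x :: B' ++ C) D) //=; first last.
  - exact: all_take1.
  - rewrite all_cat /= all_cat C_z; apply/and4P; split=> //.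
    + by apply: all_geqW A_x; rewrite ltnW ?(leq_trans xy).
    + by rewrite /= ltnW ?(leq_trans xy).
    + exact: all_geqW B'_y.
  - by rewrite -!catA /= -!catA.
  rewrite -!catA /= -!catA; congr cons; rewrite /S2 /S1.
  case: (E) (D) CDE E_s E_y {S1 S2 rowy D_z rE E's} => [|e E'] [|d D'] //=.
    by case: (C).
  (* The bumped letters satisfy b <= y < e <= d, an instance of the first relation one row down. *)
  move=> E'E eE' /andP[ye _]; apply: IH1.
  rewrite (leq_ltn_trans b_y ye); apply: (allP (order_path_min leq_trans eE')).
  by rewrite E'E mem_cat mem_head orbT.
- have [A [E [rE A_x E_x]]] := sorted_split x r_s.
  have E_s : sorted leq E by move: r_s; rewrite rE => /cat_sorted2[].
  have [C [D [CDE C_z D_z]]] := sorted_split z E_s.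
  rewrite (insert_split S rE A_x (all_take1 E_x)).
  (* If [C] is empty, one of [x], [y] bumps the freshly inserted [z]. The two bumped words are d d'
     z and d z d' with z < d <= d', so the first relation is used. *)
  case: C CDE C_z => [|c C'] CDE C_z.
    have xz : x < z := leq_ltn_trans xy yz.
    have A_y := all_geqW xy A_x; have A_z := all_geqW (ltnW xz) A_x.
    have D'_z : all (ltn z) (behead D) by case: (D) D_z => //= ? ? /andP[].
    have D'_y : all (ltn y) (behead D) by apply: all_ltnW D'_z; exact: ltnW.
    rewrite {}CDE cat0s in rE E_x E_s *.
    rewrite (@insert_split _ (rcons A x) (behead D)); first last.
    + exact: all_take1.
    + by rewrite all_rcons A_z andbT /= ltnW.
    + by rewrite cat_rcons.
    rewrite (@insert_split _ (rcons A x) (z :: behead (behead D))) //;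
      first last.
    + by rewrite /= take0 yz.
    + by rewrite all_rcons A_y /= xy.
    rewrite (insert_split S rE A_z (all_take1 D_z)).
    rewrite (@insert_split _ A (z :: behead D)) //; last by rewrite /= take0 xz.
    rewrite (@insert_split _ (rcons A x) (behead D)); first last.
    + exact: all_take1.
    + by rewrite all_rcons A_y /= xy.
    + by rewrite cat_rcons.
    rewrite /=; congr cons.
    case: D D_z E_s {rE E_x D'_z D'_y} => [|d [|d' D]] //=.
    by move=> /andP[zd _] /andP[dd' _]; rewrite IH1 ?zd.
  (* [g] is the letter bumped by [y]; it exists because [rcons C' z] ends in a letter larger than
     [y]. The other bumped letters are [c] and [d], with c <= g <= z < d, so the second relation is
     used one row down. *)
  have [F [g [G' [gE F_y yg [cg gz]]]]] :
      exists F g G', [/\ rcons C' z = F ++ g :: G', all (geq y) F, y < g &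
        c <= g /\ g <= z].
    have C'z_s : sorted leq (c :: rcons C' z).
      rewrite -rcons_cons -cats1 sorted_pairwise ?pairwise_cat;
        last exact: leq_trans.
      rewrite -sorted_pairwise; last exact: leq_trans.
      move: E_s; rewrite CDE => /cat_sorted2[-> _]; rewrite !andbT.
      by apply/allrelP=> u v /(allP C_z) /= uz; rewrite inE => /eqP->.
    have [F [G [gE F_y G_y]]] := sorted_split y (path_sorted C'z_s).
    case: G gE G_y => [|g G'] gE G_y.
      move: (allP F_y z); rewrite cats0 in gE.
      by rewrite -gE mem_rcons mem_head /= leqNgt yz => /(_ isT).
    have gC : g \in rcons C' z by rewrite gE mem_cat mem_head orbT.
    exists F, g, G'; split=> //; first by case/andP: G_y.
    split; first exact: (allP (order_path_min leq_trans C'z_s)).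
    move: gC; rewrite mem_rcons inE => /orP[/eqP-> // | gC'].
    by apply: (allP C_z); rewrite inE gC' orbT.
  have xc : x < c by move: E_x; rewrite CDE => /andP[].
  have xz : x < z := leq_ltn_trans xy yz.
  have A_y := all_geqW xy A_x; have A_z := all_geqW (ltnW xz) A_x.
  have AC_z : all (geq z) (A ++ c :: C') by rewrite all_cat A_z.
  have AxC_z : all (geq z) (A ++ x :: C').
    rewrite all_cat A_z /=; apply/andP; split; first exact: ltnW.
    by case/andP: C_z.
  have AxF_y : all (geq y) (A ++ x :: F) by rewrite all_cat A_y /= xy.
  rewrite CDE in rE *.
  have rE' : r = (A ++ c :: C') ++ D by rewrite rE -catA.
  have rowE u : (A ++ x :: C') ++ z :: u = (A ++ x :: F) ++ g :: G' ++ u.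
    by rewrite -!catA /= -(cat_rcons z) gE -catA.
  have y_g u : all (ltn y) (take 1 (g :: u)) by rewrite /= take0 yg.
  have x_c u : all (ltn x) (take 1 (c :: u)) by rewrite /= take0 xc.
  rewrite (insert_split S rE' AC_z (all_take1 D_z)).
  rewrite (@insert_split _ (A ++ x :: C') D _ _ _ AxC_z (all_take1 D_z));
    last by rewrite -catA.
  rewrite (insert_split _ (rowE _) AxF_y (y_g _)).
  rewrite (@insert_split _ A (c :: C' ++ z :: behead D) _ _ _ A_x (x_c _));
    last by rewrite -catA.
  rewrite (@insert_split _ (A ++ x :: F) (g :: G' ++ behead D) _ _ _ AxF_y
    (y_g _)); last by rewrite -rowE -catA.
  congr cons; case: (D) D_z => //= d D' /andP[zd _].
  by apply: IH2; rewrite cg (leq_ltn_trans gz zd).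
Qed.

(* A one-constructor type rather than a definition, so that [rewrite] treats
   it as a setoid relation instead of unfolding it to an equation. *)
Variant plactic (u v : seq nat) : Prop :=
  Plactic of forall T, row_sorted T -> foldl insert T u = foldl insert T v.

Notation "u =p v" := (plactic u v) (at level 70, no associativity).

#[local] Instance plactic_equiv : Equivalence plactic.
Proof.
split=> [u | u v [uv] | u v w [uv] [vw]]; split=> // T T_s; first by rewrite uv.
by rewrite uv ?vw.
Qed.

#[local] Instance cat_plactic : Proper (plactic ==> plactic ==> plactic) cat.
Proof.
move=> u u' [uu'] v v' [vv']; split=> T T_s.
by rewrite !foldl_cat uu' // vv' // foldl_insert_sorted.
Qed.

#[local] Instance cons_plactic x : Proper (plactic ==> plactic) (cons x).
Proof. by move=> u v; apply: (@cat_plactic [:: x] [:: x]). Qed.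

Lemma plactic_Schensted u v : u =p v -> Schensted u = Schensted v.
Proof. by case=> uv; apply: uv. Qed.

Lemma plactic_yzx x y z w :
  x < y <= z -> [:: y, z, x & w] =p [:: y, x, z & w].
Proof. by move=> xyz; split=> T T_s /=; rewrite (knuth_yzx_xzy T_s).1. Qed.

Lemma plactic_xzy x y z w :
  x <= y < z -> [:: x, z, y & w] =p [:: z, x, y & w].
Proof. by move=> xyz; split=> T T_s /=; rewrite (knuth_yzx_xzy T_s).2. Qed.

(** * Moving a letter between two columns *)

(** With [leq] this is the condition for two adjacent columns to form a tableau, with [ltn] the one
    for two adjacent rows; with [geq] it compares decreasing words from their large ends. *)
Fixpoint dominates (leT : rel nat) (s1 s2 : seq nat) : bool :=
  match s1, s2 with
  | _, [::] => true
  | [::], _ => false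
  | x :: s1', y :: s2' => leT x y && dominates leT s1' s2'
  end.

Lemma dominates_nil leT s : dominates leT s [::].
Proof. by case: s. Qed.

Lemma dominates_trans leT : transitive leT -> transitive (dominates leT).
Proof.
move=> leT_tr; elim=> [|y s2 IHs] [|x s1] [|z s3] //=.
move=> /andP[xy s12] /andP[yz s23].
by rewrite (leT_tr _ _ _ xy yz) IHs.
Qed.

Lemma dominates_path leT x s1 s2 : transitive leT ->
  path leT x s1 -> dominates leT s1 s2 -> dominates leT (x :: s1) s2.
Proof.
move=> leT_tr; elim: s2 x s1 => //= z s2 IHs x [|y s1] //=.
move=> /andP[xy ys] /andP[yz].
by rewrite (leT_tr _ _ _ xy yz); exact: IHs.
Qed.

Lemma dominates_cat leT s s1 s2 : transitive leT ->
  sorted leT (s ++ s1) -> dominates leT s1 s2 -> dominates leT (s ++ s1) s2.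
Proof.
move=> leT_tr; elim: s => //= x s IHs xs s12.
by apply: dominates_path => //; apply: IHs => //; exact: path_sorted xs.
Qed.

Lemma gtn_trans : transitive gtn.
Proof. by move=> y x z /= xy yz; exact: ltn_trans xy. Qed.

Lemma geq_trans : transitive geq.
Proof. by move=> y x z /= xy yz; exact: leq_trans xy. Qed.

(** Moving [x] past the letter p_i is the Knuth relation p_i x q_i = x p_i q_i, valid because p_i <=
    q_i < x. The induction hypothesis brings q_i into position and then puts it back. *)
Lemma plactic_insert_left p q x w : sorted gtn (x :: q) -> dominates geq q p ->
  p ++ x :: q ++ w =p x :: p ++ q ++ w.
Proof.
elim: p x q => [//|p1 p IHp] x [//|q1 q] xq1q /=.
have /andP[q1x q1q] := xq1q; case/andP=> p1q1 qp.
have qp' : dominates geq (q1 :: q) p.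
  apply: dominates_path => //; first exact: geq_trans.
  by apply: sub_path q1q => u v /ltnW.
rewrite (IHp x (q1 :: q)) // (IHp q1 q) //.
rewrite plactic_xzy; last by rewrite /= in p1q1 q1x *; rewrite p1q1 q1x.
by rewrite -(IHp q1 q).
Qed.

Lemma plactic_swap_left p v q w : sorted gtn (v ++ q) -> dominates geq q p ->
  p ++ v ++ q ++ w =p v ++ p ++ q ++ w.
Proof.
elim: v => //= x v IHv xvq qp.
have vq := path_sorted xvq.
have := plactic_insert_left w xvq; rewrite -!catA => ->.
  by rewrite IHv.
apply: dominates_cat => //; first exact: geq_trans.
by apply: sub_sorted vq => a b /ltnW.
Qed.

(** The mirror argument: u_i is the witness for exchanging [x] and v_i, because x < u_i <= v_i. *)
Lemma plactic_insert_right u v x w : path ltn x u -> sorted ltn v ->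
    dominates leq u v ->
  rev u ++ x :: rev v ++ w =p rev u ++ rev v ++ x :: w.
Proof.
elim: v x u w => [//|y v IHv] x [//|z u] w xzu yv /andP[zy uv].
have /andP[xz zu] := xzu.
have uv' : dominates leq (z :: u) v.
  apply: dominates_path uv; first exact: leq_trans.
  by apply: sub_path zu => a b /ltnW.
have v_s := path_sorted yv.
rewrite (rev_cons y) -!cats1 -!catA /=.
rewrite (IHv x (z :: u)) //.
rewrite (rev_cons z) -!cats1 -!catA /=.
rewrite (IHv z u) // -plactic_yzx; last by rewrite /= in xz zy *; rewrite xz.
by rewrite -(IHv z u).
Qed.

(** The [a] parts hold the letters of a column larger than [x], the [b] parts the smaller ones. Both
    sides are equivalent to [rev a1 ++ rev a2 ++ x :: b1 ++ b2 ++ w]. *)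
Lemma plactic_move a1 b1 a2 b2 x w :
    path ltn x a1 -> path ltn x a2 -> path gtn x b2 ->
    dominates leq a1 a2 -> dominates geq b2 b1 ->
  rev a1 ++ b1 ++ rev a2 ++ x :: b2 ++ w =p
  rev a1 ++ x :: b1 ++ rev a2 ++ b2 ++ w.
Proof.
move=> xa1 xa2 xb2 a12 b21.
have xb2_b1 : dominates geq (x :: b2) b1.
  apply: dominates_path b21; first exact: geq_trans.
  by apply: sub_path xb2 => u v /ltnW.
have a2xb2 : sorted gtn (rev a2 ++ x :: b2).
  rewrite sorted_pairwise; last exact: gtn_trans.
  rewrite pairwise_cat -!sorted_pairwise; try exact: gtn_trans.
  rewrite rev_sorted; apply/and3P; split=> //; last exact: path_sorted xa2.
  apply/allrelP=> u v; rewrite mem_rev => /(allP (order_path_min ltn_trans xa2)).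
  move=> xu; rewrite inE => /orP[/eqP-> // |].
  by move/(allP (order_path_min gtn_trans xb2)) => /= vx; exact: ltn_trans xu.
have a2b2 : sorted gtn (rev a2 ++ b2).
  apply: subseq_sorted a2xb2; first exact: gtn_trans.
  by rewrite cat_subseq // subseq_cons.
rewrite (@plactic_swap_left b1 (rev a2) (x :: b2)) //.
rewrite (@plactic_insert_left b1 b2 x) //.
rewrite -(@plactic_insert_right a1 a2) //; last exact: path_sorted xa2.
rewrite -(@plactic_swap_left b1 (rev a2) b2) //.
Qed.

(** * Dominance as a comparison of counts, and complements *)

Lemma dominates_count leT s1 s2 b : transitive leT -> dominates leT s1 s2 ->
  count (leT^~ b) s2 <= count (leT^~ b) s1.
Proof.
move=> leT_tr; elim: s1 s2 => [|x s1 IHs] [|y s2] //= /andP[xy /IHs].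
by case yb: (leT y b); [rewrite (leT_tr _ _ _ xy yb) | case: (leT x b)]; lia.
Qed.

(** With [dominates_count], dominance of sorted sequences becomes one inequality of counts per
    threshold [b], a form suited to complements. *)
Lemma count_dominates leT s1 s2 : reflexive leT -> transitive leT ->
    sorted leT s1 -> sorted leT s2 ->
    (forall b, b \in s2 -> count (leT^~ b) s2 <= count (leT^~ b) s1) ->
  dominates leT s1 s2.
Proof.
move=> leT_refl leT_tr; elim: s1 s2 => [|x s1 IHs] [|y s2] // xs1 ys2 s12.
  by have := s12 y (mem_head _ _); rewrite /= leT_refl.
have xy : leT x y.
  have : 0 < count (leT^~ y) (x :: s1).
    by apply: leq_trans (s12 y (mem_head _ _)); rewrite /= leT_refl.
  rewrite -has_count /= => /orP[// | /hasP[z zs1 zy]].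
  by apply: (leT_tr z) => //; apply: (allP (order_path_min leT_tr xs1)).
rewrite /= xy; apply: IHs; [exact: path_sorted xs1 | exact: path_sorted ys2 |].
move=> b bs2; have := s12 b; rewrite inE bs2 orbT => /(_ isT) /=.
have yb := allP (order_path_min leT_tr ys2) b bs2.
by rewrite yb (leT_tr _ _ _ xy yb) leq_add2l.
Qed.

(** A count in the complement is the total minus the count, so every inequality survives when the
    two sets are complemented and exchanged. *)
Lemma dominates_predC leT (s : seq nat) (C D : pred nat) :
    reflexive leT -> transitive leT -> sorted leT s ->
    dominates leT (filter C s) (filter D s) ->
  dominates leT (filter (predC D) s) (filter (predC C) s).
Proof.
move=> leT_refl leT_tr s_s CD.
have count_C E b : count (leT^~ b) (filter (predC E) s) =
    count (leT^~ b) s - count (leT^~ b) (filter E s).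
  have /permPl/permP/(_ (leT^~ b)) := perm_filterC E s.
  by rewrite count_cat => <-; rewrite addKn.
apply: count_dominates => //; try exact: sorted_filter.
by move=> b _; rewrite !count_C leq_sub2l // dominates_count.
Qed.

(** A column is a predicate on all numbers and the alphabet {a, ..., a + m - 1} is kept apart:
    dualizing is then [predC], and passing to the remaining alphabet changes only [a] and [m]. *)
Definition letters (a m : nat) (C : pred nat) : seq nat :=
  [seq x <- iota a m | C x].

Definition column_word (a m : nat) (Cs : seq (pred nat)) : seq nat :=
  flatten [seq rev (letters a m C) | C <- Cs].

Definition dual_columns (Cs : seq (pred nat)) : seq (pred nat) :=
  rev [seq (predC C : pred nat) | C : pred nat <- Cs].

Definition column_le (a m : nat) : rel (pred nat) :=
  fun C D => dominates leq (letters a m C) (letters a m D).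

Lemma column_le_predC a m C D :
  column_le a m C D -> column_le a m (predC D) (predC C).
Proof.
apply: dominates_predC; [exact: leqnn | exact: leq_trans |].
by rewrite iota_sorted.
Qed.

Lemma sorted_dual a m Cs :
  sorted (column_le a m) Cs -> sorted (column_le a m) (dual_columns Cs).
Proof.
rewrite /dual_columns rev_sorted sorted_map; apply: sub_sorted => C D.
exact: column_le_predC.
Qed.

Lemma letters_cat a m1 m2 C :
  letters a (m1 + m2) C = letters a m1 C ++ letters (a + m1) m2 C.
Proof. by rewrite /letters iotaD filter_cat. Qed.

Lemma letters_sorted a m C : sorted ltn (letters a m C).
Proof. by rewrite sorted_filter ?iota_ltn_sorted //; exact: ltn_trans. Qed.

Lemma mem_letters a m C x : (x \in letters a m C) = (a <= x < a + m) && C x.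
Proof. by rewrite mem_filter mem_iota andbC. Qed.

Lemma count_le_letters a m C b : b < a + m ->
  count (leq^~ b) (letters a m C) = size (letters a (b.+1 - a) C).
Proof.
move=> bm; have -> : m = (b.+1 - a) + (m - (b.+1 - a)) by lia.
rewrite letters_cat count_cat -[RHS]addn0; congr (_ + _).
  by apply/eqP; rewrite -all_count; apply/allP=> x; rewrite mem_letters; lia.
apply/eqP; rewrite eqn0Ngt -has_count; apply/hasPn=> x.
by rewrite mem_letters; lia.
Qed.

Lemma count_ge_letters a m C b : a <= b -> b <= a + m ->
  count (geq^~ b) (letters a m C) = size (letters b (a + m - b) C).
Proof.
move=> ab bm; have -> : m = (b - a) + (m - (b - a)) by lia.
rewrite letters_cat count_cat -[RHS]add0n; congr (_ + _).
  apply/eqP; rewrite eqn0Ngt -has_count; apply/hasPn=> x.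
  by rewrite mem_letters /=; lia.
have -> : a + (b - a) = b by lia.
have -> : a + (b - a + (m - (b - a))) - b = m - (b - a) by lia.
by apply/eqP; rewrite -all_count; apply/allP=> x; rewrite mem_letters /=; lia.
Qed.

(** The first maximum of f - g on [0, m], written additively because subtraction on [nat]
    truncates. *)
Lemma first_argmax (f g : nat -> nat) m : exists i, [/\ i <= m,
  forall j, j < i -> f j + g i < f i + g j &
  forall j, j <= m -> f j + g i <= f i + g j].
Proof.
elim: m => [|m [i [im lt_i le_i]]].
  by exists 0; split=> // j; rewrite leqn0 => /eqP->.
have [gt_m|le_m] := ltnP (f i + g m.+1) (f m.+1 + g i).
  exists m.+1; split=> // j; first by rewrite ltnS => /le_i; lia.
  by rewrite leq_eqVlt => /orP[/eqP-> //|]; rewrite ltnS => /le_i; lia.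
exists i; split=> //; first exact: leqW.
by move=> j; rewrite leq_eqVlt => /orP[/eqP-> //|]; exact: le_i.
Qed.

(* [x] is the letter that the crystal operator e_1 of gl_2 moves from the
   second column [D] to the first column [C]. *)
Definition movable (a l : nat) (C D : pred nat) (x : nat) : Prop :=
  [/\ ~~ C x, D x,
      dominates leq (letters x.+1 l C) (letters x.+1 l D) &
      dominates geq (rev (letters a (x - a) D)) (rev (letters a (x - a) C))].

Lemma movable_predC a l C D x :
  movable a l C D x -> movable a l (predC D) (predC C) x.
Proof.
case=> Cx Dx hi lo; split=> //=; first by rewrite negbK.
  apply: dominates_predC hi; [exact: leqnn | exact: leq_trans |].
  by rewrite iota_sorted.
rewrite /letters -!filter_rev in lo *; apply: dominates_predC lo.
- exact: leqnn.
- exact: geq_trans.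
by rewrite rev_sorted iota_sorted.
Qed.

Lemma movable_exists a m C D : ~~ column_le a m C D ->
  exists2 i, i < m & movable a (m - i.+1) C D (a + i).
Proof.
(* The letter sits just before the first maximum of the number of letters of [D] minus that of [C]
   among the first i letters. If this maximum is at i = 0, the columns already form a tableau. *)
pose c (E : pred nat) i := size (letters a i E).
have [i [im lt_i le_i]] := first_argmax (c D) (c C) m.
move=> CD; case: i => [|i] in im lt_i le_i *.
  case/negP: CD; apply: count_dominates.
  - exact: leqnn.
  - exact: leq_trans.
  - by apply: sub_sorted (letters_sorted a m C) => u v /ltnW.
  - by apply: sub_sorted (letters_sorted a m D) => u v /ltnW.
  move=> b; rewrite mem_letters => /andP[/andP[ab bm] _].
  rewrite !count_le_letters //.
  by have := le_i (b.+1 - a); rewrite /c /=; lia.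
have cD E u v : u <= v -> c E v = c E u + size (letters (a + u) (v - u) E).
  by move=> uv; rewrite /c -size_cat -letters_cat subnKC.
exists i => //.
have cS E : c E i.+1 = c E i + E (a + i).
  by rewrite (cD E i) ?subSnn //= /letters /=; case: (E _).
(* The difference strictly increases in the step that reaches its first maximum. *)
have [Cx Dx] : ~~ C (a + i) /\ D (a + i).
  have := lt_i i (leqnn _); rewrite !cS.
  by case: (C _) (D _) => [] [] //=; lia.
split=> //.
(* Maximality: no segment starting right after [a + i] has more letters in [D] than in [C]. *)
- apply: count_dominates.
  - exact: leqnn.
  - exact: leq_trans.
  - by apply: sub_sorted (letters_sorted _ _ C) => u v /ltnW.
  - by apply: sub_sorted (letters_sorted _ _ D) => u v /ltnW.
  move=> b; rewrite mem_letters => /andP[bm _].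
  rewrite !count_le_letters; try lia.
  have iv : i.+1 <= b.+1 - a by lia.
  have vm : b.+1 - a <= m by lia.
  have := le_i _ vm; rewrite (cD C _ _ iv) (cD D _ _ iv) addnS.
  by rewrite (_ : b.+1 - a - i.+1 = b.+1 - (a + i).+1); lia.
(* The maximum is the first one: every segment ending right before [a + i] has at least as many
   letters in [D] as in [C]. *)
- rewrite addKn; apply: count_dominates.
  - exact: leqnn.
  - exact: geq_trans.
  - by rewrite rev_sorted; apply: sub_sorted (letters_sorted _ _ D) => u v /ltnW.
  - by rewrite rev_sorted; apply: sub_sorted (letters_sorted _ _ C) => u v /ltnW.
  move=> b; rewrite mem_rev mem_letters => /andP[bm _].
  rewrite !count_rev !count_ge_letters; try lia.
  have bi : b - a <= i by lia.
  have := lt_i _ bi; rewrite !cS (negbTE Cx) Dx (cD C _ _ bi) (cD D _ _ bi).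
  have -> : a + (b - a) = b by lia.
  have -> : i - (b - a) = a + i - b by lia.
  lia.
Qed.

Lemma letters_split a m i C : i < m ->
  letters a m C = letters a i C ++
    (if C (a + i) then [:: a + i] else [::]) ++ letters (a + i).+1 (m - i.+1) C.
Proof.
move=> im; have {1}-> : m = i + (1 + (m - i.+1)) by lia.
by rewrite !letters_cat addn1.
Qed.

Lemma eq_letters a m C D :
  (forall x, a <= x < a + m -> C x = D x) -> letters a m C = letters a m D.
Proof. by move=> CD; apply: eq_in_filter => x; rewrite mem_iota; exact: CD. Qed.

Lemma letters_moved a m i C D : i < m -> (forall x, x != a + i -> C x = D x) ->
  letters a i C = letters a i D /\
  letters (a + i).+1 (m - i.+1) C = letters (a + i).+1 (m - i.+1) D.
Proof.
by move=> im CD; split; apply: eq_letters => x xi; apply: CD; lia.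
Qed.

Lemma plactic_movable a m (C D C' D' : pred nat) i w :
    i < m -> movable a (m - i.+1) C D (a + i) ->
    C' (a + i) -> ~~ D' (a + i) ->
    (forall x, x != a + i -> C' x = C x /\ D' x = D x) ->
  rev (letters a m C) ++ rev (letters a m D) ++ w =p
  rev (letters a m C') ++ rev (letters a m D') ++ w.
Proof.
move=> im [Cx Dx hi lo] C'x D'x CD'.
have [loC hiC] := letters_moved im (fun x ne => (CD' x ne).1).
have [loD hiD] := letters_moved im (fun x ne => (CD' x ne).2).
rewrite !(letters_split _ _ im) C'x (negbTE D'x) Dx (negbTE Cx).
rewrite loC loD hiC hiD !cat0s.
rewrite !rev_cat -!catA /=; rewrite addKn in lo.
have hi_gt E : path ltn (a + i) (letters (a + i).+1 (m - i.+1) E).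
  rewrite path_min_sorted ?letters_sorted //.
  by apply/allP=> y; rewrite mem_letters /=; lia.
apply: plactic_move; rewrite ?hi_gt //.
rewrite path_min_sorted ?rev_sorted ?letters_sorted //.
by apply/allP=> y; rewrite mem_rev mem_letters /=; lia.
Qed.

(** The dual pair moves the same letter because [movable] is self-dual. The statements on sizes
    serve the termination of the straightening. *)
Lemma plactic_move_columns a m C D : ~~ column_le a m C D ->
  exists C' D' : pred nat,
  [/\ size (letters a m C') + size (letters a m D') =
        size (letters a m C) + size (letters a m D),
      size (letters a m D') < size (letters a m D),
      column_word a m [:: C; D] =p column_word a m [:: C'; D'] &
      column_word a m (dual_columns [:: C; D]) =p
      column_word a m (dual_columns [:: C'; D'])].
Proof.
move=> /movable_exists[i im mov].
pose C' : pred nat := predU1 (a + i) C; pose D' : pred nat := predD1 D (a + i).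
have C'x : C' (a + i) by rewrite /C' /D' /= eqxx.
have D'x : ~~ D' (a + i) by rewrite /C' /D' /= eqxx.
have CD' x : x != a + i -> C' x = C x /\ D' x = D x.
  by rewrite /C' /D' /= => /negbTE->.
have [loC hiC] := letters_moved im (fun x ne => (CD' x ne).1).
have [loD hiD] := letters_moved im (fun x ne => (CD' x ne).2).
have [Cx Dx _ _] := mov.
have sizeC' : size (letters a m C') = (size (letters a m C)).+1.
  rewrite !(letters_split _ _ im) loC hiC C'x (negbTE Cx) !size_cat /=; lia.
have sizeD' : size (letters a m D) = (size (letters a m D')).+1.
  rewrite !(letters_split _ _ im) loD hiD Dx (negbTE D'x) !size_cat /=; lia.
exists C', D'; split=> //.
- by rewrite sizeC' sizeD' addSnnS.
- by rewrite sizeD'.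
- exact: plactic_movable im mov C'x D'x CD'.
rewrite /dual_columns /=.
apply: (plactic_movable [::] im (movable_predC mov)) => //=.
  by rewrite negbK.
by move=> x /CD'[/= -> ->].
Qed.

(** * Straightening a sequence of columns *)

(** This is the sum of j * |C_j| over the columns, numbered from 0; moving a letter one column to
    the left lowers it. *)
Fixpoint weight (a m : nat) (Cs : seq (pred nat)) : nat :=
  if Cs is _ :: Cs' then weight a m Cs' + size (column_word a m Cs') else 0.

Lemma not_sorted_split (T : Type) (r : rel T) s : ~~ sorted r s ->
  exists s1 x y s2, s = s1 ++ [:: x, y & s2] /\ ~~ r x y.
Proof.
elim: s => [//|x [//|y s] IHs] /=; rewrite negb_and => /orP[rxy | /IHs].
  by exists [::], x, y, s.
by case=> s1 [x' [y' [s2 [-> rxy]]]]; exists (x :: s1), x', y', s2.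
Qed.

Lemma column_word_cat a m Cs Ds :
  column_word a m (Cs ++ Ds) = column_word a m Cs ++ column_word a m Ds.
Proof. by rewrite /column_word map_cat flatten_cat. Qed.

Lemma dual_columns_cat Cs Ds :
  dual_columns (Cs ++ Ds) = dual_columns Ds ++ dual_columns Cs.
Proof. by rewrite /dual_columns map_cat rev_cat. Qed.

Lemma weight_move a m Xs C D Ys C' D' :
    size (letters a m C') + size (letters a m D') =
      size (letters a m C) + size (letters a m D) ->
    size (letters a m D') < size (letters a m D) ->
  weight a m (Xs ++ [:: C', D' & Ys]) < weight a m (Xs ++ [:: C, D & Ys]).
Proof.
move=> eq_size lt_size; elim: Xs => [|X Xs IHXs] /=.
  by rewrite !size_cat !size_rev; lia.
by rewrite !column_word_cat /= !size_cat !size_rev; lia.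
Qed.

(** Adjacent pairs that do not form a tableau are repaired one at a time, with [weight] decreasing.
    Each repair respects both plactic classes, so a single [Ds] serves the sequence and its dual. *)
Lemma straighten a m Cs : exists Ds,
  [/\ size Ds = size Cs, sorted (column_le a m) Ds,
      column_word a m Cs =p column_word a m Ds &
      column_word a m (dual_columns Cs) =p column_word a m (dual_columns Ds)].
Proof.
have [w] := ubnP (weight a m Cs); elim: w Cs => // w IHw Cs le_w.
have [Cs_s | ] := boolP (sorted (column_le a m) Cs); first by exists Cs.
case/not_sorted_split=> Xs [C [D [Ys [CsE CD]]]].
have [C' [D' [eq_size lt_size CD'p CD'd]]] := plactic_move_columns CD.
have [|Ds [sizeDs Ds_s Dsp Dsd]] := IHw (Xs ++ [:: C', D' & Ys]).
  by have := weight_move Xs Ys eq_size lt_size; rewrite CsE in le_w; lia.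
have split2 (E F : pred nat) : Xs ++ [:: E, F & Ys] = Xs ++ [:: E; F] ++ Ys by [].
exists Ds; split=> //.
- by rewrite sizeDs CsE !size_cat.
- by rewrite -Dsp CsE !split2 !column_word_cat CD'p.
- by rewrite -Dsd CsE !split2 !dual_columns_cat !column_word_cat CD'd.
Qed.

(** * Tableaux and their columns *)

Definition row_of (cols : seq (seq nat)) (i : nat) : seq nat :=
  pmap (fun c => onth c i) cols.

Arguments row_of : simpl never.

Definition rows_of (h : nat) (cols : seq (seq nat)) : seq (seq nat) :=
  [seq row_of cols i | i <- iota 0 h].

Definition tab_of (h : nat) (cols : seq (seq nat)) : tableau :=
  [seq r <- rows_of h cols | r != [::]].

Lemma row_of_cons c cols i : row_of (c :: cols) i =
  if onth c i is Some x then x :: row_of cols i else row_of cols i.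
Proof. by rewrite /row_of /=; case: (onth c i). Qed.

Lemma path_dominates_nil leT s :
  path (dominates leT) [::] s -> s = nseq (size s) [::].
Proof. by elim: s => //= -[|x r] s IHs //= /IHs {1}->. Qed.

Lemma row_of_nseq n i : row_of (nseq n [::]) i = [::].
Proof. by elim: n => //= n; rewrite /row_of /= onth0n. Qed.

Lemma flatten_nseq_nil (T : Type) n : flatten (nseq n (@nil T)) = [::].
Proof. by elim: n. Qed.

Lemma dominates_size leT s1 s2 : dominates leT s1 s2 -> size s2 <= size s1.
Proof. by elim: s1 s2 => [|x s1 IHs] [|y s2] //= /andP[_ /IHs]. Qed.

Lemma dominates_onth leT s1 s2 i x y : dominates leT s1 s2 ->
  onth s1 i = Some x -> onth s2 i = Some y -> leT x y.
Proof.
elim: s1 s2 i => [|u s1 IHs] [|v s2] [|i] //= /andP[uv s12]; last exact: IHs.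
by move=> [<-] [<-].
Qed.

(** Column lengths weakly decrease, so [pmap] skips only trailing columns and positions are kept. As
    only lengths matter, [leT] is arbitrary; this allows the lemma to be reused with the rows of a
    tableau in place of [cols]. *)
Lemma onth_row_of leT cols i j : sorted (dominates leT) cols ->
  onth (row_of cols i) j = onth (nth [::] cols j) i.
Proof.
elim: cols j => [|c cols IHcols] j c_s; first by rewrite nth_nil !onth0n.
have cols_s := path_sorted c_s.
rewrite /row_of /=; case ci: (onth c i) => [x|] /=.
  by case: j => [|j] //=; exact: IHcols.
have {ci} ci : size c <= i by rewrite -onthNE ci.
have -> : pmap (fun c => onth c i) cols = [::].
  elim: cols c ci {IHcols cols_s} c_s => //= d cols IHcols c ci /andP[cd d_s].
  have di := leq_trans (dominates_size cd) ci.
  by rewrite onth_default // (IHcols d).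
rewrite onth0n; case: j => [|j] /=; first by rewrite onth_default.
elim: cols c j ci {IHcols cols_s} c_s => [|d cols IHcols] c j ci /=.
  by rewrite nth_nil onth0n.
move=> /andP[cd d_s]; have di := leq_trans (dominates_size cd) ci.
by case: j => [|j] /=; [rewrite onth_default | exact: (IHcols d)].
Qed.

Lemma row_of_path cols c i x : path (dominates leq) c cols ->
  onth c i = Some x -> path leq x (row_of cols i).
Proof.
elim: cols c x => //= d cols IHcols c x /andP[cd d_s] ci.
rewrite /row_of /=; case di: (onth d i) => [y|] /=.
  by rewrite (dominates_onth cd ci di) (IHcols d).
have := @onth_row_of leq (d :: cols) i 0 d_s.
rewrite /row_of /= di /= => {}di.
by case: (pmap _ cols) di.
Qed.

Lemma row_of_sorted cols i :
  sorted (dominates leq) cols -> sorted leq (row_of cols i).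
Proof.
elim: cols => //= c cols IHcols c_s.
rewrite /row_of /=; case ci: (onth c i) => [x|] /=.
  exact: row_of_path ci.
exact: IHcols (path_sorted c_s).
Qed.

Lemma dominates_row_of leT ltT cols i :
    sorted (dominates leT) cols -> all (sorted ltT) cols ->
  dominates ltT (row_of cols i) (row_of cols i.+1).
Proof.
elim: cols => //= c cols IHcols c_s /andP[c_lt cols_lt].
have IH := IHcols (path_sorted c_s) cols_lt.
rewrite !row_of_cons; case ci1: (onth c i.+1) => [y|].
  have iy : i.+1 < size c by rewrite -onthTE ci1.
  have ix := ltnW iy; rewrite -onthTE in ix.
  case ci: (onth c i) ix => [x|] // _ /=; apply/andP; split=> //.
  rewrite -(onth_nth 0 _ _ _ ci) -(onth_nth 0 _ _ _ ci1).
  exact: (sortedP 0 c_lt _ iy).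
suff -> : row_of cols i.+1 = [::] by rewrite dominates_nil.
have := @onth_row_of leT (c :: cols) i.+1 0 c_s.
by rewrite row_of_cons [nth _ _ _]/= ci1; case: (row_of cols i.+1).
Qed.

Lemma rows_of_sorted h cols :
    sorted (dominates leq) cols -> all (sorted ltn) cols ->
  sorted (dominates ltn) (rows_of h cols).
Proof.
move=> cols_s cols_lt; apply/(sortedP [::]) => i.
rewrite size_map size_iota => ih.
rewrite !(nth_map 0) ?size_iota ?(ltnW ih) // !nth_iota ?(ltnW ih) //.
exact: dominates_row_of cols_s cols_lt.
Qed.

(** Empty rows can only be trailing, so removing them shifts no other row. *)
Lemma nth_filter_nil leT (T : seq (seq nat)) i : sorted (dominates leT) T ->
  nth [::] [seq r <- T | r != [::]] i = nth [::] T i.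
Proof.
elim: T i => //= r T IHT i r_s; case: r r_s => [|x r] r_s /=.
  rewrite (path_dominates_nil r_s); set n := size T.
  have -> : [seq r <- nseq n [::] | r != [::] :> seq nat] = [::].
    by elim: n {r_s} => //.
  by case: i => [|i] //=; rewrite nth_nseq if_same.
by case: i => //= i; apply: IHT; exact: path_sorted r_s.
Qed.

Lemma entry_tab_of h cols i j :
    sorted (dominates leq) cols -> all (sorted ltn) cols ->
    all (fun c => size c <= h) cols ->
  entry (tab_of h cols) i j = onth (nth [::] cols j) i.
Proof.
move=> cols_s cols_lt cols_h.
rewrite /entry (nth_filter_nil _ (rows_of_sorted h cols_s cols_lt)).
have [ih | hi] := ltnP i h.
  by rewrite (nth_map 0) ?size_iota // nth_iota // (onth_row_of _ _ cols_s).
rewrite nth_default ?size_map ?size_iota // onth0n onth_default //.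
apply: leq_trans hi; case: (ltnP j (size cols)) => [jk | kj].
  exact: (all_nthP [::] cols_h).
by rewrite nth_default.
Qed.

(** The letters of [r] bump those of [s] one by one and in order, so [s] enters the next rows as a
    word. In the induction [pre] collects the letters already placed. *)
Lemma foldl_insert_row pre r s S :
    sorted leq (pre ++ r) -> dominates ltn r s ->
  foldl insert ((pre ++ s) :: S) r = (pre ++ r) :: foldl insert S s.
Proof.
elim: r pre s S => [|x r IHr] pre s S r_s rs; first by case: s rs.
have pre_x : all (geq x) pre.
  move: r_s; rewrite sorted_pairwise ?pairwise_cat; last exact: leq_trans.
  case/andP=> /allrelP pre_r _; apply/allP=> y ypre.
  exact: pre_r ypre (mem_head _ _).
rewrite -cat_rcons in r_s *.
rewrite [LHS]/(foldl _ (insert _ _) _) (@insert_split _ pre s) //.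
  rewrite -cat_rcons; case: s rs => [|y s] /=; last by case/andP=> _; exact: IHr.
  by move=> _; apply: (IHr _ [::]) => //; exact: dominates_nil.
by case: s rs => //= y s /andP[-> _]; rewrite take0.
Qed.

Lemma foldl_insert_cons r (T : tableau) :
    all (fun s => s != [::]) (r :: T) -> all (sorted leq) (r :: T) ->
    sorted (dominates ltn) (r :: T) ->
  foldl insert T r = r :: T.
Proof.
elim: T r => [|s T IHT] r /= /andP[r0 T0] /andP[r_s T_s].
  have := @foldl_insert_row [::] r [::] [::] r_s (dominates_nil _ _).
  by case: r r0 r_s.
case/andP=> rs T_lt; rewrite (@foldl_insert_row [::] r s) //.
by rewrite IHT.
Qed.

Lemma Schensted_rows (T : tableau) :
    all (fun s => s != [::]) T -> all (sorted leq) T ->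
    sorted (dominates ltn) T ->
  Schensted (flatten (rev T)) = T.
Proof.
elim: T => //= r T IHT T0 T_s T_lt.
rewrite rev_cons -cats1 flatten_cat /= cats0 /Schensted foldl_cat.
rewrite [foldl _ [::] _]IHT ?foldl_insert_cons //.
- by case/andP: T0.
- by case/andP: T_s.
- exact: path_sorted T_lt.
Qed.

Lemma flatten_filter_nil (T : seq (seq nat)) :
  flatten [seq r <- T | r != [::]] = flatten T.
Proof. by elim: T => //= -[|x r] T IHT //=; rewrite IHT. Qed.

Lemma Schensted_tab_of h cols :
    sorted (dominates leq) cols -> all (sorted ltn) cols ->
  Schensted (flatten (rev (rows_of h cols))) = tab_of h cols.
Proof.
move=> cols_s cols_lt; rewrite -flatten_filter_nil filter_rev Schensted_rows //.
- exact: filter_all.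
- apply/allP=> r; rewrite mem_filter => /andP[_ /mapP[i _ ->]].
  exact: row_of_sorted.
- rewrite sorted_filter ?rows_of_sorted //.
  by apply: dominates_trans; exact: ltn_trans.
Qed.

(** * Plactic equivalence of the row reading and column reading words *)

Lemma plactic_slide d x z w : x <= z -> path ltn z d ->
  rev d ++ [:: x, z & w] =p x :: rev d ++ z :: w.
Proof.
elim: d z w => [//|y d IHd] z w xz /= /andP[zy yd].
rewrite rev_cons -cats1 -!catA /=.
rewrite -(@plactic_xzy x z y) ?xz //.
by apply: IHd => //; apply: leq_trans xz (ltnW zy).
Qed.

Lemma plactic_slide_row d r s w : sorted leq (rcons r s) -> path ltn s d ->
  rev d ++ r ++ s :: w =p r ++ rev d ++ s :: w.
Proof.
elim: r => //= x r IHr xr sd.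
have {}IHr := IHr (path_sorted xr) sd.
rewrite -IHr; case: r xr {IHr} => [|z r] /= /andP[xz zr].
  exact: plactic_slide.
apply: plactic_slide => //.
have zs : z <= s.
  by apply: (allP (order_path_min leq_trans zr)); rewrite mem_rcons mem_head.
by case: d sd => //= y d /andP[sy ->]; rewrite (leq_ltn_trans zs sy).
Qed.

(** In the induction [r] collects the top entries of the columns already passed. The rest [d] of the
    current column moves past [r] by [plactic_slide_row], with the top entry [s] as witness. *)
Lemma plactic_top_row cols r :
    sorted (dominates leq) cols -> all (sorted ltn) cols ->
    sorted leq (r ++ row_of cols 0) ->
  flatten [seq rev (behead c) | c <- cols] ++ r ++ row_of cols 0 =p
  r ++ flatten [seq rev c | c <- cols].
Proof.
elim: cols r => [//|[|s d] cols IHcols] r c_s.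
  rewrite row_of_cons /= (path_dominates_nil c_s) row_of_nseq.
  by rewrite !map_nseq !flatten_nseq_nil.
have cols_s := path_sorted c_s.
rewrite row_of_cons /= => /andP[sd cols_lt] r_s.
rewrite -cat_rcons in r_s *.
rewrite -catA IHcols // rev_cons -cats1 -!catA /= cat_rcons.
by apply: plactic_slide_row => //; case/cat_sorted2: r_s.
Qed.

Lemma rows_ofS h cols :
  rows_of h.+1 cols = row_of cols 0 :: rows_of h (map behead cols).
Proof.
rewrite /rows_of /= -(addn0 1) iotaDl -map_comp; congr cons.
apply: eq_map => i /=; rewrite /row_of.
by elim: cols => //= -[|x c] cols ->; rewrite ?onth0n.
Qed.

Lemma plactic_rows_of h cols :
    sorted (dominates leq) cols -> all (sorted ltn) cols ->
    all (fun c => size c <= h) cols ->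
  flatten (rev (rows_of h cols)) =p flatten [seq rev c | c <- cols].
Proof.
elim: h cols => [|h IHh] cols cols_s cols_lt cols_h.
  rewrite /=; elim: cols {cols_s cols_lt} cols_h => //= -[] //.
rewrite rows_ofS rev_cons -cats1 flatten_cat /= cats0 IHh.
- rewrite -map_comp; apply: (@plactic_top_row cols [::]) => //.
  exact: row_of_sorted.
- rewrite sorted_map; apply: sub_sorted cols_s => -[|x c] [|y d] //=.
    by rewrite dominates_nil.
  by case/andP.
- by rewrite all_map; apply: sub_all cols_lt => -[|x c] //= /path_sorted.
- by rewrite all_map; apply: sub_all cols_h => -[|x c].
Qed.

(** * Catabolism and duality *)

Definition column_tab (a m : nat) (Cs : seq (pred nat)) : tableau :=
  tab_of m [seq letters a m C | C <- Cs].

Lemma sorted_letters a m Cs : sorted (column_le a m) Cs ->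
  sorted (dominates leq) [seq letters a m C | C <- Cs].
Proof. by rewrite sorted_map. Qed.

Lemma all_letters_sorted a m Cs :
  all (sorted ltn) [seq letters a m C | C <- Cs].
Proof. by elim: Cs => //= C Cs ->; rewrite letters_sorted. Qed.

Lemma all_letters_size a m Cs :
  all (fun c => size c <= m) [seq letters a m C | C <- Cs].
Proof.
elim: Cs => //= C Cs ->; rewrite andbT.
by rewrite size_filter -{2}(size_iota a m) count_size.
Qed.

Lemma nth_letters a m Cs j : nth [::] [seq letters a m C | C <- Cs] j =
  letters a m (nth xpred0 Cs j).
Proof.
have [js | sj] := ltnP j (size Cs); first exact: nth_map.
by rewrite !nth_default ?size_map // /letters filter_pred0.
Qed.

Lemma entry_column_tab a m Cs i j : sorted (column_le a m) Cs ->
  entry (column_tab a m Cs) i j = onth (letters a m (nth xpred0 Cs j)) i.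
Proof.
move=> Cs_s; rewrite entry_tab_of ?nth_letters ?all_letters_size //.
  exact: sorted_letters.
exact: all_letters_sorted.
Qed.

Lemma Schensted_column_word a m Cs w : sorted (column_le a m) Cs ->
  w =p column_word a m Cs -> Schensted w = column_tab a m Cs.
Proof.
move=> Cs_s /plactic_Schensted->.
have Ls := sorted_letters Cs_s.
have Ll := all_letters_sorted a m Cs.
rewrite /column_tab -(Schensted_tab_of _ Ls Ll); apply/esym/plactic_Schensted.
rewrite plactic_rows_of ?all_letters_size // -map_comp.
reflexivity.
Qed.

(** The rectangle condition in terms of columns; in this form it is visibly stable under
    complementing and reversing, with [c] replaced by [size Cs - c]. *)
Definition has_rect (a e c : nat) (Cs : seq (pred nat)) : Prop :=
  forall j x, j < size Cs -> a <= x < a + e -> nth xpred0 Cs j x = (j < c).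

Lemma letters_full a m (C : pred nat) :
  (forall x, a <= x < a + m -> C x) -> letters a m C = iota a m.
Proof.
by move=> CT; apply/all_filterP/allP=> x; rewrite mem_iota; exact: CT.
Qed.

Lemma letters_empty a m (C : pred nat) :
  (forall x, a <= x < a + m -> C x = false) -> letters a m C = [::].
Proof.
move=> C0; apply/eqP; rewrite -[_ == _]negbK -has_filter; apply/hasPn=> x.
by rewrite mem_iota => /C0->.
Qed.

Lemma onth_iota a m i : onth (iota a m) i = if i < m then Some (a + i) else None.
Proof.
by elim: m a i => [|m IHm] a [|i] //=; rewrite ?addn0 // IHm addSnnS.
Qed.

Lemma has_rect_letters a e m c Cs j : has_rect a e c Cs -> c <= size Cs ->
  letters a (e + m) (nth xpred0 Cs j) =
  (if j < c then iota a e else [::]) ++ letters (a + e) m (nth xpred0 Cs j).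
Proof.
move=> rect cs; rewrite letters_cat; congr (_ ++ _).
have [js | sj] := ltnP j (size Cs).
  case: ifP => jc; [apply: letters_full | apply: letters_empty] => x;
    by move/(rect _ _ js)->.
by rewrite nth_default // ltnNge (leq_trans cs sj) /letters filter_pred0.
Qed.

(** The alphabet of the rectangle comes first, so its letters stand at the top of each column; a
    column containing all of them has [a + i] in row i for i < e. *)
Lemma restrict_column_tabP a e m c Cs :
    sorted (column_le a (e + m)) Cs -> c <= size Cs ->
  restrict (alphabet a (e, c)) (entry (column_tab a (e + m) Cs)) =2
    rect_tab a (e, c) <-> has_rect a e c Cs.
Proof.
move=> Cs_s cs; split=> [res j x js xa | rect i j]; last first.
  rewrite /restrict entry_column_tab // (has_rect_letters _ _ rect cs).
  rewrite /rect_tab /alphabet /= onth_cat.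
  have hi l : obind (fun x => if a <= x < a + e then Some x else None)
      (onth (letters (a + e) m (nth xpred0 Cs j)) l) = None.
    case E: (onth _ _) => [y|] //=.
    have : y \in letters (a + e) m (nth xpred0 Cs j) by apply/onthP; exists l.
    by rewrite mem_letters; case: ifP => //; lia.
  case: (ltnP j c) => jc; rewrite ?andbF ?andbT ?size_iota ?hi //.
  by rewrite onth_iota; case: ltnP => // ie /=; rewrite ifT //; lia.
move: res; rewrite /restrict /rect_tab /alphabet /= => res.
apply/idP/idP => [Cx | jc].
  have : x \in letters a (e + m) (nth xpred0 Cs j) by rewrite mem_letters Cx; lia.
  case/onthP=> i xi; have := res i j.
  rewrite entry_column_tab // xi /= xa.
  by case: (j < c); rewrite ?andbF.
have := res (x - a) j; rewrite entry_column_tab // jc.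
have -> : x - a < e by lia.
have -> : a + (x - a) = x by lia.
rewrite /=; case E: (onth _ _) => [y|] //=; case: ifP => // _ [yx].
have : y \in letters a (e + m) (nth xpred0 Cs j) by apply/onthP; exists (x - a).
by rewrite mem_letters yx => /andP[].
Qed.

(** * Row reading words of slices *)

Lemma pmap_row_nil (F : filling) i (s : seq nat) :
  (forall j, j \in s -> F i j = None) -> pmap (F i) s = [::].
Proof.
elim: s => //= j s IHs F0; rewrite F0 ?mem_head //=.
by apply: IHs => l ls; apply: F0; rewrite inE ls orbT.
Qed.

Lemma flatten_map_nil (T : eqType) (U : Type) (f : T -> seq U) s :
  (forall x, x \in s -> f x = [::]) -> flatten [seq f x | x <- s] = [::].
Proof.
elim: s => //= x s IHs f0; rewrite f0 ?mem_head // IHs // => y ys.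
by rewrite f0 // inE ys orbT.
Qed.

(** [CCat] reads the cells in the bounding box of the tableau; this passes to the box with e + m
    rows and [size Cs] columns, which does not depend on the shape. *)
Lemma row_reading_widen h w h' w' F : h <= h' -> w <= w' ->
    (forall i j, (h <= i) || (w <= j) -> F i j = None) ->
  row_reading h' w' F = row_reading h w F.
Proof.
move=> hh' ww' F0; rewrite /row_reading -(subnKC hh') -(subnKC ww').
rewrite [iota 0 (h + _)]iotaD rev_cat map_cat flatten_cat.
rewrite flatten_map_nil ?cat0s => [|i]; last first.
  rewrite mem_rev mem_iota => /andP[hi _].
  by apply: pmap_row_nil => j _; rewrite F0 // hi.
congr flatten; apply: eq_map => i.
rewrite iotaD pmap_cat [X in _ ++ X]pmap_row_nil ?cats0 // => j.
by rewrite mem_iota => /andP[wj _]; rewrite F0 // wj orbT.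
Qed.

Lemma pmap_nth (T U : Type) (f : T -> option U) x0 (s : seq T) :
  pmap (fun j => f (nth x0 s j)) (iota 0 (size s)) = pmap f s.
Proof.
rewrite -[in RHS](mkseq_nth x0 s) /mkseq.
by elim: (iota _ _) => //= j r ->.
Qed.

Lemma row_reading_columns h cols :
  row_reading h (size cols) (fun i j => onth (nth [::] cols j) i) =
  flatten (rev (rows_of h cols)).
Proof.
rewrite /row_reading /rows_of -map_rev; congr flatten; apply: eq_map => i.
exact: pmap_nth.
Qed.

Lemma eq_row_reading h w F G :
    (forall i j, i < h -> j < w -> F i j = G i j) ->
  row_reading h w F = row_reading h w G.
Proof.
move=> FG; rewrite /row_reading; congr flatten; apply/eq_in_map => i.
rewrite mem_rev mem_iota add0n => /andP[_ ih]; have {}FG j := FG i j ih.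
elim: w FG => // w IHw FG; rewrite -addn1 iotaD !pmap_cat /= FG ?leqnn //.
by rewrite IHw // => j jw; rewrite FG // leqW.
Qed.

Lemma row_reading_right_slice c h w F :
  row_reading h (c + w) (right_slice c F) =
  row_reading h w (fun i j => F i (c + j)).
Proof.
rewrite /row_reading; congr flatten; apply: eq_map => i.
rewrite iotaD pmap_cat pmap_row_nil => [|j]; last first.
  by rewrite mem_iota /right_slice => /andP[_]; rewrite add0n ltnNge; case: leqP.
have -> : iota (0 + c) w = [seq c + j | j <- iota 0 w] by rewrite -iotaDl addn0.
rewrite cat0s; elim: (iota _ _) => //= j r ->.
by rewrite /right_slice leq_addr.
Qed.

Lemma row_reading_left_slice c h w F :
  row_reading h (c + w) (left_slice c F) = row_reading h c F.
Proof.
rewrite /row_reading; congr flatten; apply: eq_map => i.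
rewrite iotaD pmap_cat [X in _ ++ X]pmap_row_nil => [|j]; last first.
  by rewrite mem_iota /left_slice => /andP[cj _]; rewrite ltnNge cj.
rewrite cats0; apply: eq_in_pmap => j.
by rewrite mem_iota /left_slice => /andP[_ ->].
Qed.

Lemma row_reading_skip_rows e h w F :
    (forall i j, i < e -> F i j = None) ->
  row_reading (e + h) w F = row_reading h w (fun i j => F (e + i) j).
Proof.
move=> F0; rewrite /row_reading iotaD rev_cat map_cat flatten_cat.
rewrite [X in _ ++ X]flatten_map_nil ?cats0 => [|i]; last first.
  rewrite mem_rev mem_iota => /andP[_ ie].
  by apply: pmap_row_nil => j _; exact: F0.
have -> : iota (0 + e) h = [seq e + i | i <- iota 0 h] by rewrite -iotaDl addn0.
by rewrite -map_rev -map_comp.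
Qed.

Lemma dominates_cat2l leT s s1 s2 : reflexive leT ->
  dominates leT (s ++ s1) (s ++ s2) = dominates leT s1 s2.
Proof. by move=> leT_refl; elim: s => //= x s ->; rewrite leT_refl. Qed.

Lemma has_rect_sorted a e m c Cs :
    has_rect a e c Cs -> c <= size Cs -> sorted (column_le a (e + m)) Cs ->
  sorted (column_le (a + e) m) (drop c Cs) /\
  sorted (column_le (a + e) m) (take c Cs).
Proof.
move=> rect cs Cs_s.
have le_next j : j.+1 < size Cs -> (j < c) = (j.+1 < c) ->
    column_le (a + e) m (nth xpred0 Cs j) (nth xpred0 Cs j.+1).
  move=> js jc; have := sortedP xpred0 Cs_s j js.
  by rewrite /column_le !(has_rect_letters m _ rect cs) -jc dominates_cat2l.
split; apply/(sortedP xpred0) => j.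
  rewrite size_drop => jc; rewrite !nth_drop addnS.
  apply: le_next; first by rewrite -addnS -ltn_subRL.
  by rewrite !ltnNge leq_addr leqW ?leq_addr.
rewrite size_takel // => jc; rewrite !nth_take ?(ltnW jc) //.
by apply: le_next; rewrite ?jc ?(ltnW jc) // (leq_trans jc).
Qed.

Lemma row_reading_letters a m Cs h : sorted (column_le a m) Cs -> m <= h ->
  row_reading h (size Cs) (fun i j => onth (letters a m (nth xpred0 Cs j)) i) =p
  column_word a m Cs.
Proof.
move=> Cs_s mh.
rewrite /column_word -(size_map (letters a m)).
rewrite (eq_row_reading (G := fun i j =>
  onth (nth [::] [seq letters a m C | C <- Cs] j) i)); last first.
  by move=> i j _ _; rewrite nth_letters.
rewrite row_reading_columns plactic_rows_of ?sorted_letters ?all_letters_sorted //.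
  by rewrite -map_comp; reflexivity.
by apply: sub_all (all_letters_size a m Cs) => c /leq_trans; exact.
Qed.

Lemma entry_support a m Cs i j : sorted (column_le a m) Cs ->
    (size (column_tab a m Cs) <= i) ||
    (head 0 (shape (column_tab a m Cs)) <= j) ->
  entry (column_tab a m Cs) i j = None.
Proof.
move=> Cs_s /orP[hi | wj]; first by rewrite /entry nth_default // onth0n.
have : entry (column_tab a m Cs) 0 j = None.
  rewrite /entry onth_default //; move: wj.
  by case: (column_tab a m Cs).
rewrite !entry_column_tab //; case: (letters _ _ _) => //=.
by rewrite onth0n.
Qed.

Lemma size_column_tab a m Cs : size (column_tab a m Cs) <= m.
Proof.
by rewrite size_filter (leq_trans (count_size _ _)) // size_map size_iota.
Qed.

Lemma width_column_tab a m Cs :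
  head 0 (shape (column_tab a m Cs)) <= size Cs.
Proof.
rewrite /column_tab /tab_of.
have : all (fun r => size r <= size Cs)
    [seq r <- rows_of m [seq letters a m C | C <- Cs] | r != [::]].
  apply/allP=> r; rewrite mem_filter => /andP[_ /mapP[i _ ->]].
  by rewrite size_pmap (leq_trans (count_size _ _)) // !size_map.
by case: filter => //= r T /andP[].
Qed.

(** The columns of the right slice contain no letter of the first alphabet, and those of the left
    slice lose exactly their top [e] cells. After a shift by [c] columns, respectively [e] rows,
    both slices have partition shape, so their row words are equivalent to their column words. *)
Lemma CCat_column_tab a e m c Cs :
    sorted (column_le a (e + m)) Cs -> c <= size Cs -> has_rect a e c Cs ->
  exists2 w, CCat a (e, c) (column_tab a (e + m) Cs) = Schensted w &
    w =p column_word (a + e) m (drop c Cs ++ take c Cs).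
Proof.
move=> Cs_s cs rect; set T := column_tab a (e + m) Cs.
exists (row_reading (e + m) (size Cs)
          (right_slice c (remove (entry T) (rect_tab a (e, c)))) ++
        row_reading (e + m) (size Cs)
          (left_slice c (remove (entry T) (rect_tab a (e, c))))).
  rewrite /CCat; congr (Schensted (_ ++ _)); apply/esym/row_reading_widen;
    rewrite ?size_column_tab ?width_column_tab // => i j /entry_support ij.
    rewrite /right_slice /remove ij //; case: ifP => //; case: rect_tab => //.
  by rewrite /left_slice /remove ij //; case: ifP => //; case: rect_tab.
have [r_s l_s] := has_rect_sorted rect cs Cs_s.
rewrite column_word_cat -(subnKC cs).
rewrite row_reading_right_slice.
rewrite (@row_reading_skip_rows e m _ (left_slice c _)).
  rewrite -/(left_slice c (fun i j =>
    remove (entry T) (rect_tab a (e, c)) (e + i) j)) row_reading_left_slice.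
  apply: cat_plactic.
    rewrite -(row_reading_letters r_s (leq_addl e m)) size_drop.
    rewrite (eq_row_reading (G := fun i j =>
      onth (letters (a + e) m (nth xpred0 (drop c Cs) j)) i)); first reflexivity.
    move=> i j _ _; have cjc : (c + j < c) = false by rewrite ltnNge leq_addr.
    rewrite /remove /rect_tab /= cjc andbF nth_drop.
    by rewrite entry_column_tab // (has_rect_letters _ _ rect cs) cjc.
  rewrite -(row_reading_letters l_s (leqnn m)) size_takel //.
  rewrite (eq_row_reading (G := fun i j =>
    onth (letters (a + e) m (nth xpred0 (take c Cs) j)) i)); first reflexivity.
  move=> i j _ jc; have eie : (e + i < e) = false by rewrite ltnNge leq_addr.
  rewrite /remove /rect_tab /= eie nth_take // entry_column_tab //.
  by rewrite (has_rect_letters _ _ rect cs) jc onth_cat size_iota eie addKn.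
move=> i j ie; rewrite /left_slice /remove /rect_tab /= ie.
by case: (j < c).
Qed.

(** * Duality of one catabolism step and the induction on rectangles *)

Lemma size_dual_columns Cs : size (dual_columns Cs) = size Cs.
Proof. by rewrite size_rev size_map. Qed.

Lemma nth_dual_columns Cs j x : j < size Cs ->
  nth xpred0 (dual_columns Cs) j x = ~~ nth xpred0 Cs (size Cs - j.+1) x.
Proof.
move=> js; rewrite nth_rev ?size_map // (nth_map xpred0) // ltn_subrL /=.
by case: (Cs) js.
Qed.

Lemma has_rect_dual a e c Cs : c <= size Cs ->
  has_rect a e c Cs <-> has_rect a e (size Cs - c) (dual_columns Cs).
Proof.
move=> cs; split=> rect j x.
  rewrite size_dual_columns => js xa; rewrite nth_dual_columns // rect //; last by lia.
  by rewrite -leqNgt; lia.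
move=> js xa; have js' : size Cs - j.+1 < size Cs by lia.
have := rect (size Cs - j.+1) x; rewrite size_dual_columns => /(_ js' xa).
rewrite nth_dual_columns // (_ : size Cs - (size Cs - j.+1).+1 = j); last by lia.
by move=> /(congr1 negb); rewrite negbK => ->; lia.
Qed.

(** Exchanging the two slices rotates the column sequence, and reversal turns a rotation at [c] into
    one at [size Cs - c]. *)
Lemma dual_rotation c Cs : c <= size Cs ->
  drop (size Cs - c) (dual_columns Cs) ++ take (size Cs - c) (dual_columns Cs) =
  dual_columns (drop c Cs ++ take c Cs).
Proof.
move=> cs; rewrite dual_columns_cat /dual_columns drop_rev take_rev.
by rewrite !size_map subKn // map_take map_drop.
Qed.

(** In the induction the number of columns [size Cs] stays fixed, because rotation and straightening
    keep it, while the letters shrink to those after the first alphabet. *)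
Lemma catabolizable_dual eta mu a m Cs :
    size eta = size mu -> sumn eta = m -> all (leq^~ (size Cs)) mu ->
    sorted (column_le a m) Cs ->
  col_catabolizable_from a (zip eta mu) (column_tab a m Cs) <->
  col_catabolizable_from a (zip eta [seq size Cs - c | c <- mu])
    (column_tab a m (dual_columns Cs)).
Proof.
elim: eta mu a m Cs => [|e eta IH] [|c mu] a m Cs //= => [_ <- // |].
move=> [eq_size] <- /andP[cs mu_le] Cs_s; set m' := sumn eta in Cs_s *.
have dCs_s := sorted_dual Cs_s.
have cs' : size Cs - c <= size (dual_columns Cs).
  by rewrite size_dual_columns leq_subr.
have rectP := restrict_column_tabP Cs_s cs.
have rectP' := restrict_column_tabP dCs_s cs'.
have dualP := has_rect_dual a e cs.
(* The two catabolisms are compared only under the rectangle condition, which [dualP] transfers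
   between the two sides. *)
suff step : has_rect a e c Cs ->
    col_catabolizable_from (a + e) (zip eta mu)
      (CCat a (e, c) (column_tab a (e + m') Cs)) <->
    col_catabolizable_from (a + e) (zip eta [seq size Cs - c | c <- mu])
      (CCat a (e, size Cs - c) (column_tab a (e + m') (dual_columns Cs))).
  split=> -[res cat]; first have rect := rectP.1 res.
    by split; [apply/rectP'.2/dualP.1 | apply/(step rect).1].
  have rect := dualP.2 (rectP'.1 res).
  by split; [apply/rectP.2 | apply/(step rect).2].
move=> rect.
have [w -> wE] := CCat_column_tab Cs_s cs rect.
have [w' -> w'E] := CCat_column_tab dCs_s cs' (dualP.1 rect).
(* One straightening computes both catabolisms: [Ds] gives the columns of one, [dual_columns Ds]
   those of the other. *)
have [Ds [sizeDs Ds_s DsE DsE']] :=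
  straighten (a + e) m' (drop c Cs ++ take c Cs).
have {}sizeDs : size Ds = size Cs.
  by rewrite sizeDs size_cat addnC -size_cat cat_take_drop.
rewrite dual_rotation // DsE' in w'E; rewrite DsE in wE.
rewrite (Schensted_column_word Ds_s wE).
rewrite (Schensted_column_word (sorted_dual Ds_s) w'E) -sizeDs.
by apply: IH; rewrite ?sizeDs.
Qed.

(** * Column sequences of column strict tableaux *)

Lemma pmap_onth (T : Type) (s : seq T) k : size s <= k ->
  pmap (onth s) (iota 0 k) = s.
Proof.
elim: s k => [|x s IHs] [|k] //= sk.
  by elim: (iota _ _) => //= i r ->; rewrite ?onth0n.
rewrite -(addn0 1) iotaDl -[in RHS](IHs k) //; congr cons.
by elim: (iota _ _) => //= i r ->.
Qed.

Lemma size_row_le n S i : cstab n S ->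
  size (nth [::] S i) <= head 0 (shape S).
Proof.
case/and5P=> _ S_geq _ _ _.
have -> : size (nth [::] S i) = nth 0 (shape S) i.
  have [iS | Si] := ltnP i (size S); first by rewrite (nth_map [::]).
  by rewrite !nth_default ?size_map.
case: (shape S) S_geq => [|l sh] l_s; first by rewrite nth_nil.
case: i => [//|i] /=; have [ish | shi] := ltnP i (size sh).
  by apply: (allP (order_path_min geq_trans l_s)); exact: mem_nth.
by rewrite nth_default.
Qed.

(** The trivial relation retains only the row lengths, which is what the lemmas on [row_of] need
    when the rows of [S] play the part of columns. *)
Lemma cstab_shape n S : cstab n S -> sorted (dominates (fun _ _ => true)) S.
Proof.
case/and5P=> _; rewrite sorted_map => + _ _ _; apply: sub_sorted.
by elim=> [|x r IHr] [|y s] //=; exact: IHr.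
Qed.

Lemma onth_column n S i j :
  cstab n S -> onth (column S j) i = onth (nth [::] S i) j.
Proof. by move=> S_cs; exact: onth_row_of (cstab_shape S_cs). Qed.

Lemma column_sorted n S j : cstab n S -> sorted ltn (column S j).
Proof.
move=> S_cs; have [_ _ _ _] := and5P S_cs.
move=> /allP/(_ j); rewrite mem_iota add0n /=.
case: ltnP => [_ -> // | kj _].
suff -> : column S j = [::] by [].
apply: eq_from_onth => i; rewrite (onth_column _ _ S_cs) onth0n onth_default //.
exact: leq_trans (size_row_le i S_cs) kj.
Qed.

Lemma letters_column n S j : cstab n S ->
  letters 1 n (mem (column S j)) = column S j.
Proof.
move=> S_cs.
apply: (irr_sorted_eq ltn_trans ltnn (letters_sorted _ _ _)
  (column_sorted j S_cs)).
move=> x; rewrite mem_letters add1n ltnS andbC /=.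
case xS: (x \in column S j) => //=.
have /onthP[i] := xS; rewrite (onth_column _ _ S_cs) => xi.
have xr : x \in nth [::] S i by apply/onthP; exists j.
have iS : i < size S.
  by case: ltnP xr => // Si; rewrite nth_default.
have [_ _ /(all_nthP [::])/(_ i iS)/allP/(_ x xr) x_n _ _] := and5P S_cs.
exact: x_n.
Qed.

Definition tableau_columns (k : nat) (S : tableau) : seq (pred nat) :=
  [seq (mem (column S j) : pred nat) | j <- iota 0 k].

Lemma row_of_map (T : Type) (f : T -> seq nat) s i :
  row_of [seq f j | j <- s] i = pmap (fun j => onth (f j) i) s.
Proof. by rewrite /row_of; elim: s => //= j s ->. Qed.

Lemma letters_tableau_columns n k S : cstab n S ->
  [seq letters 1 n C | C <- tableau_columns k S] =
  [seq column S j | j <- iota 0 k].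
Proof.
move=> S_cs; rewrite -map_comp; apply: eq_map => j; exact: letters_column.
Qed.

(** No row is empty, so the first column meets every row, and it is a strictly increasing sequence
    in [n]. *)
Lemma size_cstab n S : cstab n S -> size S <= n.
Proof.
move=> S_cs; case: (posnP (size S)) => [-> // | S_gt0].
have : (size S).-1 < size (column S 0).
  rewrite -onthTE (onth_column _ _ S_cs) onthTE.
  have [S0 _ _ _ _] := and5P S_cs.
  move/(all_nthP [::]): S0 => /(_ (size S).-1).
  by case: nth => [|x r] //=; rewrite prednK // leqnn => /(_ isT).
rewrite prednK // => /leq_trans; apply.
rewrite -(letters_column _ S_cs).
have := all_letters_size 1 n [:: (mem (column S 0) : pred nat)].
by rewrite /= andbT.
Qed.

Lemma column_tab_tableau_columns n k S :
    cstab n S -> head 0 (shape S) <= k ->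
  column_tab 1 n (tableau_columns k S) = S.
Proof.
move=> S_cs S_le_k.
rewrite /column_tab (letters_tableau_columns _ S_cs) /tab_of.
(* The rows from [size S] to n - 1 are empty and will be removed by the filter of [tab_of]. *)
have -> : rows_of n [seq column S j | j <- iota 0 k] =
    S ++ nseq (n - size S) [::].
  apply: (@eq_from_nth _ [::]); rewrite size_map size_iota.
    by rewrite size_cat size_nseq subnKC ?(size_cstab S_cs).
  move=> i ik; rewrite (nth_map 0) ?size_iota // nth_iota // row_of_map.
  rewrite (eq_pmap (fun j => onth_column _ j S_cs)) pmap_onth; last first.
    exact: leq_trans (size_row_le _ S_cs) S_le_k.
  by rewrite nth_cat; case: ltnP => // Si; rewrite nth_nseq if_same nth_default.
rewrite filter_cat; have [/all_filterP-> _ _ _ _] := and5P S_cs.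
by rewrite (_ : [seq _ <- _ | _] = [::]) ?cats0 //; elim: (n - size S).
Qed.

Lemma dual_tab_tableau_columns n k S :
  column_tab 1 n (dual_columns (tableau_columns k S)) = dual_tab n k S.
Proof.
rewrite /column_tab /tab_of /dual_tab; congr filter; apply: eq_map => i.
rewrite -row_of_map; congr (row_of _ i).
apply: (@eq_from_nth _ [::]); first by rewrite !size_map size_rev !size_map.
move=> j; rewrite size_map size_dual_columns size_map size_iota => jk.
rewrite nth_letters (nth_map 0) ?size_iota // nth_iota // add0n.
apply: eq_filter => x; rewrite nth_dual_columns size_map size_iota //.
rewrite (nth_map 0) ?size_iota ?nth_iota; try lia.
by rewrite /= subnS add0n -!subn1 subnAC.
Qed.

Lemma tableau_columns_sorted n k S : cstab n S ->
  sorted (column_le 1 n) (tableau_columns k S).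
Proof.
move=> S_cs; have [_ _ _ S_leq _] := and5P S_cs.
rewrite /tableau_columns sorted_map.
(* Neighbours in [iota] are j and j + 1; the weakly increasing rows make column j dominate column j
   + 1, by [dominates_row_of] with rows and columns exchanged. *)
apply: (@sub_sorted _ (fun j l => l == j.+1)).
  move=> j l /eqP-> /=; rewrite /column_le !(letters_column _ S_cs).
  exact: dominates_row_of (cstab_shape S_cs) S_leq.
by elim: k 0 => //= -[|k] //= IHk j; rewrite eqxx IHk.
Qed.

Theorem proposition9 (t n k : nat) (eta mu : t.-tuple nat) (S : tableau)
    (eta_gt0 : all (fun h => 0 < h) eta)
    (eta_sum : sumn eta = n)
    (S_cs : cstab n S)
    (k_gt0 : 0 < k)
    (S_le_k : head 0 (shape S) <= k)
    (mu_le_k : all (fun m => m <= k) mu) :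
  col_catabolizable (zip eta mu) S <->
  col_catabolizable (zip eta [seq k - m | m <- mu]) (dual_tab n k S).
Proof.
have size_k : size (tableau_columns k S) = k by rewrite size_map size_iota.
rewrite -dual_tab_tableau_columns.
rewrite -{1}(column_tab_tableau_columns S_cs S_le_k).
have := @catabolizable_dual eta mu 1 n (tableau_columns k S).
rewrite size_k; apply; rewrite ?size_tuple //.
exact: tableau_columns_sorted.
Qed.
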